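(* For $n\ge5$ the semigroup $\mathcal{E}_n=\mathrm{End}(\mathcal{T}_n)$ is left abundant (and hence left Fountain), right Fountain but not right abundant.
   Context: $\mathcal{T}_n$ is the full transformation semigroup of all maps $\{1,\dots,n\}\to\{1,\dots,n\}$, and $\mathcal{E}_n=\mathrm{End}(\mathcal{T}_n)$ is the monoid of all semigroup endomorphisms of $\mathcal{T}_n$ (not required to fix the identity map) under composition. Maps are written on the right and composed left to right ($\alpha\beta$ means first $\alpha$, then $\beta$). Relations on the monoid $\mathcal{E}_n$: $\alpha\mathrel{\mathscr{R}^*}\beta$ iff for all $\gamma,\delta\in\mathcal{E}_n$, $\gamma\alpha=\delta\alpha\Leftrightarrow\gamma\beta=\delta\beta$; $\alpha\mathrel{\mathscr{L}^*}\beta$ iff for all $\gamma,\delta\in\mathcal{E}_n$, $\alpha\gamma=\alpha\delta\Leftrightarrow\beta\gamma=\beta\delta$; $\alpha\mathrel{\widetilde{\mathscr{R}}}\beta$ iff for all idempotents $\eta\in\mathcal{E}_n$, $\eta\alpha=\alpha\Leftrightarrow\eta\beta=\beta$; $\alpha\mathrel{\widetilde{\mathscr{L}}}\beta$ iff for all idempotents $\eta\in\mathcal{E}_n$, $\alpha\eta=\alpha\Leftrightarrow\beta\eta=\beta$. A semigroup is left [right] abundant if every $\mathscr{R}^*$-class [resp. $\mathscr{L}^*$-class] contains an idempotent; it is left [right] Fountain if every $\widetilde{\mathscr{R}}$-class [resp. $\widetilde{\mathscr{L}}$-class] contains an idempotent. *)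

(* Defs.v *)
From HB Require Import structures.
From mathcomp Require Import all_boot.

Set Implicit Arguments.
Unset Strict Implicit.
Unset Printing Implicit Defensive.

Local Open Scope group_scope.

Section AbundantFountain.

(* Over a general semigroup S, the relations Rstar and Lstar quantify over S
   with an identity adjoined; for a monoid M this is M itself. *)
Variable M : monoidType.
Implicit Types a b c d e : M.

Definition idempotent_elt e : Prop := e * e = e.

Definition Rstar a b : Prop :=
  forall c d, c * a = d * a <-> c * b = d * b.

Definition Lstar a b : Prop :=
  forall c d, a * c = a * d <-> b * c = b * d.

Definition Rtilde a b : Prop :=
  forall e, idempotent_elt e -> (e * a = a <-> e * b = b).

Definition Ltilde a b : Prop :=
  forall e, idempotent_elt e -> (a * e = a <-> b * e = b).

Definition every_class_has_idempotent (K : M -> M -> Prop) : Prop :=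
  forall a, exists2 e, idempotent_elt e & K a e.

Definition left_abundant : Prop := every_class_has_idempotent Rstar.
Definition right_abundant : Prop := every_class_has_idempotent Lstar.
Definition left_Fountain : Prop := every_class_has_idempotent Rtilde.
Definition right_Fountain : Prop := every_class_has_idempotent Ltilde.

End AbundantFountain.

Arguments left_abundant M : clear implicits.
Arguments right_abundant M : clear implicits.
Arguments left_Fountain M : clear implicits.
Arguments right_Fountain M : clear implicits.

(* A separate name for {ffun 'I_n -> 'I_n}, so that its product is composition
   and not the pointwise product that {ffun _ -> _} inherits from its codomain.
   As maps are written on the right, x * y is first x, then y. *)
Definition transf (n : nat) : Type := {ffun 'I_n -> 'I_n}.

HB.instance Definition _ n := Finite.copy (transf n) {ffun 'I_n -> 'I_n}.

Section TransfMonoid.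

Variable n : nat.
Implicit Types x y z : transf n.

Definition transf_mul x y : transf n := [ffun i => y (x i)].
Definition transf_one : transf n := [ffun i => i].

Lemma transf_mulA : associative transf_mul.
Proof. by move=> x y z; apply/ffunP => i; rewrite !ffunE. Qed.

Lemma transf_mul1 : left_id transf_one transf_mul.
Proof. by move=> x; apply/ffunP => i; rewrite !ffunE. Qed.

Lemma transf_mulr1 : right_id transf_one transf_mul.
Proof. by move=> x; apply/ffunP => i; rewrite !ffunE. Qed.

HB.instance Definition _ :=
  isMonoid.Build (transf n) transf_mulA transf_mul1 transf_mulr1.

End TransfMonoid.

(* Semigroup endomorphisms: the image of 1 is unconstrained.  The condition is
   boolean, so that two endomorphisms with the same values are equal. *)
Record transf_End (n : nat) := TransfEnd {
  transf_End_fun :> {ffun transf n -> transf n};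
  transf_End_axiom : [forall x : transf n, forall y : transf n,
    transf_End_fun (x * y) == transf_End_fun x * transf_End_fun y]
}.

HB.instance Definition _ n := [isSub for @transf_End_fun n].
HB.instance Definition _ n := [Finite of transf_End n by <:].

Section TransfEndMonoid.

Variable n : nat.
Implicit Types f g h : transf_End n.

Lemma transf_EndM f (x y : transf n) : f (x * y) = f x * f y.
Proof. by have /forallP/(_ x)/forallP/(_ y)/eqP := transf_End_axiom f. Qed.

HB.instance Definition _ f := isMultiplicative.Build _ _ _ (transf_EndM f).

Lemma transf_End_eqP f g : f =1 g <-> f = g.
Proof. by split=> [fg|-> //]; apply/val_inj/ffunP. Qed.

Fact transf_End_mul_axiom f g :
  let h := [ffun x : transf n => g (f x)] in
  [forall x : transf n, forall y : transf n, h (x * y) == h x * h y].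
Proof.
by apply/forallP => x; apply/forallP => y; rewrite !ffunE !transf_EndM.
Qed.

Fact transf_End_one_axiom :
  let h := [ffun x : transf n => x] in
  [forall x : transf n, forall y : transf n, h (x * y) == h x * h y].
Proof. by apply/forallP => x; apply/forallP => y; rewrite !ffunE. Qed.

Definition transf_End_mul f g : transf_End n :=
  TransfEnd (transf_End_mul_axiom f g).
Definition transf_End_one : transf_End n := TransfEnd transf_End_one_axiom.

Lemma transf_End_mulA : associative transf_End_mul.
Proof. by move=> f g h; apply/transf_End_eqP => x; rewrite !ffunE. Qed.

Lemma transf_End_mul1 : left_id transf_End_one transf_End_mul.
Proof. by move=> f; apply/transf_End_eqP => x; rewrite !ffunE. Qed.

Lemma transf_End_mulr1 : right_id transf_End_one transf_End_mul.
Proof. by move=> f; apply/transf_End_eqP => x; rewrite !ffunE. Qed.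

HB.instance Definition _ := isMonoid.Build (transf_End n)
  transf_End_mulA transf_End_mul1 transf_End_mulr1.

End TransfEndMonoid.

(* Main.v *)
Require Import Defs.
From mathcomp Require Import all_boot all_fingroup all_solvable.

(** The heart of the matter is a description of the endomorphisms of T_n for
    n >= 5: an endomorphism f that is not injective only sees whether a map is
    an odd permutation, an even permutation, or singular.  It sends these three
    kinds to t, t * t and e, where t ^ 3 = t, t e = e t = e and e ^ 2 = e
    ([noninjective_collapse]).

    If f identifies two permutations, the permutations with the same image as
    the identity form a nontrivial normal subgroup of S_n.  It meets A_n
    nontrivially because S_n has trivial centre, so it contains A_n because
    A_n is simple ([even_on_permutations]).  Even permutations may then be
    inserted freely inside a product without changing its value under f, and
    inserting a suitable one in a singular map lowers its rank; descending to
    rank 1 shows that f is constant on singular maps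
    ([constant_on_singular]).

    If f is injective on S_n, then f is injective.  The permutations f s act
    on the fixed points of the idempotent f 1; this gives an injection of S_n
    into itself, hence a surjection, which forces f 1 = 1 and f(S_n) = S_n.
    The right zeros of T_n are the constant maps, so their images are fixed by
    left multiplication by all of S_n and are again constant maps, with values
    pi i say.  Comparing the products of a constant map with x shows that f x
    is the conjugate of x by the bijection pi ([injective_of_permutations]).

    The four claims then only involve collapsing endomorphisms.
    - Left abundance: endomorphisms with the same kernel are R*-related.  The
      kernel of a collapsing endomorphism is one of three congruences, each of
      which is the kernel of an idempotent; an injective f has the kernel of 1.
    - Right Fountain: if f g = f for an idempotent g distinct from 1, then f is
      itself idempotent ([idempotent_of_fixed]).  Hence a non-idempotent f has
      no idempotent right identity but 1, which makes it L~-related to 1.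
    - Failure of right abundance: collapse onto two distinct singular
      idempotents t and e.  The result f is not idempotent, so an idempotent
      L*-related to f could only be 1; but f is not left cancellable, since
      the image of f does not contain any permutation. *)

Set Implicit Arguments.
Unset Strict Implicit.
Unset Printing Implicit Defensive.

Section EndTransf.

Local Open Scope group_scope.

Variable n : nat.
Implicit Types (x y z t e : transf n) (s u v : 'S_n) (i j p q : 'I_n).
Implicit Types (f g : transf_End n).

(** * Permutations and constant maps inside the transformation monoid *)

Lemma transfME x y i : (x * y) i = y (x i).
Proof. by rewrite ffunE. Qed.

Lemma transf1E i : (1 : transf n) i = i.
Proof. by rewrite ffunE. Qed.

Lemma transf_EndME f g x : (f * g) x = g (f x).
Proof. by rewrite ffunE. Qed.

Lemma transf_End1E x : (1 : transf_End n) x = x.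
Proof. by rewrite ffunE. Qed.

Definition of_perm s : transf n := val s.

Lemma of_permE s i : of_perm s i = s i.
Proof. by rewrite -pvalE. Qed.

Lemma of_perm1 : of_perm 1 = 1.
Proof. by apply/ffunP => i; rewrite of_permE perm1 transf1E. Qed.

Lemma of_permM s u : of_perm (s * u) = of_perm s * of_perm u.
Proof. by apply/ffunP => i; rewrite transfME !of_permE permM. Qed.

Definition cst i : transf n := [ffun=> i].

Lemma cstE i j : cst i j = i.
Proof. by rewrite ffunE. Qed.

Lemma mul_cst x i : x * cst i = cst i.
Proof. by apply/ffunP => j; rewrite transfME !cstE. Qed.

Lemma cst_mul i x : cst i * x = cst (x i).
Proof. by apply/ffunP => j; rewrite transfME !cstE. Qed.

Lemma exists_notin (r : seq 'I_n) : size r < n -> exists i, i \notin r.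
Proof.
move=> lt_r_n; apply/existsP; rewrite -negb_forall; apply: contraL lt_r_n.
move=> /forallP r_all; rewrite -leqNgt -[n in n <= _]card_ord.
apply: leq_trans (card_size r); apply/subset_leq_card/subsetP => i _.
exact: r_all.
Qed.

(** Four points leave room for a 3-cycle through q and r that avoids p. *)
Lemma even_perm_move p q r : 3 < n -> q != p -> r != p ->
  exists s, [/\ ~~ s, s q = r & s p = p].
Proof.
move=> n_gt3 qp rp; have [->|qr] := eqVneq q r.
  by exists 1; rewrite odd_perm1 !perm1.
have [z] := @exists_notin [:: p; q; r] n_gt3.
rewrite !inE !negb_or => /and3P[zp zq zr].
exists (tperm q r * tperm q z); split.
- by rewrite odd_permM !odd_tperm qr eq_sym zq.
- by rewrite permM tpermL tpermD // eq_sym.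
- by rewrite permM !tpermD // eq_sym // eq_sym.
Qed.

(** * Endomorphisms that identify two permutations *)

Lemma exists_odd_tperm : 1 < n -> exists i j, odd_perm (tperm i j).
Proof.
move=> n_gt1; have [i _] := @exists_notin [::] (ltnW n_gt1).
have [j] := @exists_notin [:: i] n_gt1; rewrite inE eq_sym => ij.
by exists i, j; rewrite odd_tperm.
Qed.

(** The permutations that f identifies with 1 form a normal subgroup; a
    commutator of one of them with a transposition is even and, the centre
    being trivial, can be made nontrivial.  Simplicity of A_n does the rest. *)
Lemma even_on_permutations f s u : 4 < n -> s != u ->
  f (of_perm s) = f (of_perm u) -> forall v, ~~ v -> f (of_perm v) = f 1.
Proof.
move=> n_gt4 s_neq_u fsu.
pose K := [set v | f (of_perm v) == f 1].
have inK v : reflect (f (of_perm v) = f 1) (v \in K).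
  by rewrite inE; apply: eqP.
have K_group : group_set K.
  apply/group_setP; split=> [|v w /inK fv /inK fw]; apply/inK.
    by rewrite of_perm1.
  by rewrite of_permM transf_EndM fv fw -transf_EndM mulg1.
pose KG := Group K_group.
have KJ v w : v \in K -> v ^ w \in K.
  move=> /inK fv; apply/inK; rewrite /conjg !of_permM !transf_EndM fv.
  by rewrite -!transf_EndM mul1g -of_permM mulVg of_perm1.
have [k kK k_neq1] : exists2 k, k \in K & k != 1.
  exists (s * u^-1); last by rewrite -eq_mulgV1.
  apply/inK; rewrite of_permM transf_EndM fsu -transf_EndM -of_permM mulgV.
  by rewrite of_perm1.
have [i ki] : exists i, k i != i.
  apply/existsP; rewrite -negb_forall; apply: contraNN k_neq1 => /forallP k1.
  apply/eqP/permP => i; rewrite perm1.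
  exact/eqP/(k1 i).
(* k moves i, and the transposition of k i with z fixes i but moves k i, so
   that it cannot commute with k. *)
have [z] := @exists_notin [:: i; k i] (ltnW (ltnW n_gt4)).
rewrite !inE negb_or => /andP[zi zki].
pose c := [~ k, tperm (k i) z].
have cK : c \in KG by rewrite groupM ?groupV ?KJ.
have c_even : c \in 'Alt_('I_n).
  by rewrite Alt_even odd_permM odd_permV odd_permJ addbb.
have c_neq1 : c != 1.
  apply/commgP => /permP/(_ i); rewrite !permM tpermL (tpermD ki zi).
  by apply/eqP.
have /simpleP[_ Alt_simple] : simple 'Alt_('I_n).
  by apply: simple_Alt5; rewrite card_ord.
have KA_normal : (KG :&: 'Alt_('I_n))%G <| 'Alt_('I_n)%G.
  apply/andP; split; first exact: subsetIr.
  rewrite normsI ?normG //; apply/subsetP => w _; rewrite inE.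
  by apply/subsetP => _ /imsetP[v vK ->]; apply: KJ.
have [KA1|KA] := Alt_simple _ KA_normal.
  by case/negP: c_neq1; rewrite -in_set1 -[[set 1]]KA1 inE cK.
by move=> v v_even; apply/inK; move: v_even; rewrite -Alt_even -KA => /setIP[].
Qed.

(** Rank descent.  Take p and q in the image of x and a outside of it, an even
    permutation s that sends q to a and fixes p, and the retraction r onto the
    image of x that sends all other points to p.  Then f does not distinguish
    x = x r from x s r, whose rank is smaller because s r sends both p and q
    to p. *)
Lemma singular_collapse f : 3 < n ->
  (forall s, ~~ s -> f (of_perm s) = f 1) ->
  forall x, ~ injective x -> exists i, f x = f (cst i).
Proof.
move=> n_gt3 f_even x; have [m] := ubnP #|x @: setT|.
elim: m x => // m IHm x lt_x_m x_sing.
have [i0 _] := @exists_notin [::] (leq_ltn_trans (leq0n _) n_gt3).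
have [x_const|] := boolP [forall i, x i == x i0].
  exists (x i0); congr (f _); apply/ffunP => i; rewrite cstE.
  exact/eqP/(forallP x_const).
rewrite negb_forall => /existsP[i1 pq].
have [a a_notin] : exists a, a \notin x @: setT.
  apply/existsP; rewrite -negb_forall; apply/negP => /forallP x_onto.
  apply: x_sing; suff /imset_injP x_inj : #|x @: setT| == #|[set: 'I_n]|.
    by move=> i j; apply: x_inj; rewrite inE.
  rewrite eqn_leq leq_imset_card /=; apply/subset_leq_card/subsetP => i _.
  exact: x_onto.
set p := x i0 in pq *; set q := x i1 in pq *.
have p_im : p \in x @: setT by rewrite imset_f ?inE.
have q_im : q \in x @: setT by rewrite imset_f ?inE.
have ap : a != p by apply: contraNneq a_notin => ->.
have [s [s_even sq sp]] := even_perm_move n_gt3 pq ap.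
pose r : transf n := [ffun i => if i \in x @: setT then i else p].
have xr : x * r = x.
  by apply/ffunP => i; rewrite transfME ffunE imset_f ?inE.
have fx : f x = f (x * of_perm s * r).
  by rewrite 2!transf_EndM f_even // -2!transf_EndM mulg1 xr.
rewrite fx; apply: IHm; last first.
  move=> y_inj; apply: x_sing => i j xij; apply: y_inj.
  by rewrite !transfME xij.
have -> : (x * of_perm s * r) @: setT = (fun i => r (s i)) @: (x @: setT).
  rewrite -imset_comp; apply: eq_imset => i.
  by rewrite !transfME of_permE.
rewrite ltnS in lt_x_m; apply: leq_trans lt_x_m.
rewrite ltn_neqAle leq_imset_card andbT.
apply/negP => /imset_injP r_inj; case/negP: pq; apply/eqP/r_inj => //.
by rewrite sp sq !ffunE p_im (negPf a_notin).
Qed.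

(** Any two constant maps differ by right multiplication by an even
    permutation, so the descent always ends at the same value. *)
Lemma constant_on_singular f : 3 < n ->
  (forall s, ~~ s -> f (of_perm s) = f 1) ->
  exists e, forall x, ~ injective x -> f x = e.
Proof.
move=> n_gt3 f_even.
have [i0 _] := @exists_notin [::] (leq_ltn_trans (leq0n _) n_gt3).
exists (f (cst i0)) => x x_sing.
have [i ->] := singular_collapse n_gt3 f_even x_sing.
have [p] := @exists_notin [:: i; i0] (ltnW n_gt3).
rewrite !inE negb_or ![p == _]eq_sym => /andP[ip i0p].
have [s [s_even si _]] := even_perm_move n_gt3 ip i0p.
by rewrite -si -of_permE -cst_mul transf_EndM f_even // -transf_EndM mulg1.
Qed.

(** * Endomorphisms that are injective on permutations *)

(** With E = f 1, each f s restricts to a permutation of the fixed points of E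
    and is determined by that restriction.  Extending it by the identity gives
    an injective, hence surjective, self-map of S_n, although all its values
    fix every point moved by E: so E moves nothing. *)
Lemma permutations_onto f : 1 < n -> injective (f \o of_perm) ->
  forall u, exists s, f (of_perm s) = of_perm u.
Proof.
move=> n_gt1 g_inj; pose g s := f (of_perm s); pose E := g 1.
have gM s u : g s * g u = g (s * u) by rewrite /g of_permM transf_EndM.
have EE i : E (E i) = E i by rewrite -transfME gM mulg1.
have Eg s i : g s (E i) = g s i by rewrite -transfME gM mul1g.
have gE s i : E (g s i) = g s i by rewrite -transfME gM mulg1.
pose act s i := if E i == i then g s i else i.
have actK s : cancel (act s) (act s^-1).
  move=> i; rewrite /act; have [Ei|/negPf Ei] := eqVneq (E i) i.
    by rewrite gE eqxx -transfME gM mulgV.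
  by rewrite Ei.
pose h s := perm (can_inj (actK s)).
have h_inj : injective h.
  move=> s u /permP hsu; apply: g_inj; apply/ffunP => i /=.
  by have := hsu (E i); rewrite !permE /act EE eqxx !Eg.
have E1 i : E i = i.
  apply/eqP; apply: contraT => Ei.
  have [q] := @exists_notin [:: i] n_gt1; rewrite inE => qi.
  have := f_invF h_inj (tperm i q) => /permP/(_ i).
  by rewrite tpermL permE /act (negPf Ei) => iq; rewrite iq eqxx in qi.
move=> u; exists (invF h_inj u); rewrite -{2}(f_invF h_inj u).
by apply/ffunP => i; rewrite of_permE permE /act E1 eqxx.
Qed.

(** Since x c = c for every constant map c, the map f c absorbs f x on its
    left, and in particular any permutation: f c is constant.  Applying f to
    c_i x = c_(x i) then identifies f with a conjugation. *)
Lemma injective_of_permutations f : 1 < n -> injective (f \o of_perm) ->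
  injective f.
Proof.
move=> n_gt1 g_inj; have f_onto := permutations_onto n_gt1 g_inj.
have [i0 _] := @exists_notin [::] (ltnW n_gt1).
pose pi i := f (cst i) i0.
have f_cst i : f (cst i) = cst (pi i).
  apply/ffunP => j; rewrite cstE; have [s fs] := f_onto (tperm i0 j).
  rewrite /pi -{2}(mul_cst (of_perm s) i) transf_EndM fs.
  by rewrite transfME of_permE tpermL.
have f_pi x i : f x (pi i) = pi (x i).
  have := congr1 f (cst_mul i x); rewrite transf_EndM !f_cst cst_mul.
  by move=> /ffunP/(_ i0); rewrite !cstE.
have pi_onto j : exists i, pi i = j.
  have [s fs] := f_onto (tperm (pi i0) j); exists (s i0).
  by rewrite -of_permE -f_pi fs of_permE tpermL.
have [rho rhoK] := fin_all_exists pi_onto.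
have piK : cancel pi rho by apply: canF_sym => j; apply: rhoK.
by move=> x y fxy; apply/ffunP => i; apply: (can_inj piK); rewrite -!f_pi fxy.
Qed.

(** * Collapsing endomorphisms *)

Definition parity x : option bool :=
  omap (fun s : 'S_n => s : bool) (insub x).

Variant parity_spec : transf n -> option bool -> Prop :=
  | ParityPerm s : parity_spec (of_perm s) (Some (s : bool))
  | ParitySingular x of ~ injective x : parity_spec x None.

Lemma parityP x : parity_spec x (parity x).
Proof.
rewrite /parity; case: insubP => [s _ <-|/injectiveP x_sing] /=.
  exact: ParityPerm.
exact: ParitySingular.
Qed.

Lemma parity_perm s : parity (of_perm s) = Some (s : bool).
Proof. by rewrite /parity /of_perm valK. Qed.

Lemma parity1 : parity 1 = Some false.
Proof. by rewrite -of_perm1 parity_perm odd_perm1. Qed.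

Lemma parity_singular x : ~ injective x -> parity x = None.
Proof.
by case: parityP => // s; case=> i j; rewrite !of_permE => /perm_inj.
Qed.

Lemma parity_cst i : 1 < n -> parity (cst i) = None.
Proof.
move=> n_gt1; apply: parity_singular => c_inj.
have [j] := @exists_notin [:: i] n_gt1.
by rewrite inE => /eqP; case; apply: c_inj; rewrite !cstE.
Qed.

Lemma parityM x y :
  parity (x * y) =
  if (parity x, parity y) is (Some a, Some b) then Some (a (+) b) else None.
Proof.
case: (parityP x) => [s|{}x x_sing]; last first.
  apply: parity_singular => xy_inj; apply: x_sing => i j xij.
  by apply: xy_inj; rewrite !transfME xij.
case: (parityP y) => [u|{}y y_sing].
  by rewrite -of_permM parity_perm odd_permM.
apply: parity_singular => xy_inj; apply: y_sing => i j yij.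
apply: (@perm_inj _ s^-1); apply: xy_inj.
by rewrite !transfME !of_permE !permKV.
Qed.

Definition collapse t e x :=
  match parity x with
  | Some true => t
  | Some false => t * t
  | None => e
  end.

Definition collapsing_pair t e :=
  [/\ t * t * t = t, t * e = e, e * t = e & e * e = e].

Lemma collapse_end t e :
  collapsing_pair t e -> exists f, f =1 collapse t e.
Proof.
move=> [ttt te et ee].
have cM : [forall x : transf n, forall y : transf n,
  finfun (collapse t e) (x * y)
    == (finfun (collapse t e) x : transf n) * finfun (collapse t e) y].
  apply/forallP => x; apply/forallP => y; rewrite !ffunE /collapse parityM.
  by case: (parity x) (parity y) => [[]|] [[]|] //=;
    rewrite -?mulgA ?te ?(mulgA e) ?et ?ee ?et ?te // !mulgA ?ttt.
by exists (TransfEnd cM) => x; rewrite ffunE.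
Qed.

Lemma noninjective_collapse f : 4 < n -> ~ injective f ->
  exists t e, collapsing_pair t e /\ f =1 collapse t e.
Proof.
move=> n_gt4 f_ninj.
have [s [u [su fsu]]] : exists s u, s != u /\ f (of_perm s) = f (of_perm u).
  have [/injectiveP g_inj|] := boolP (injectiveb (f \o of_perm)).
    case: f_ninj; apply: injective_of_permutations g_inj.
    exact: leq_trans n_gt4.
  by case/injectivePn => s [u su fsu]; exists s, u; rewrite eq_sym in su *.
have f_even := even_on_permutations n_gt4 su fsu.
have [e f_sing] := constant_on_singular (ltnW n_gt4) f_even.
have n_gt1 : 1 < n by apply: leq_ltn_trans n_gt4.
have [i0 [i1 tau_odd]] := exists_odd_tperm n_gt1.
pose tau := tperm i0 i1; pose t := f (of_perm tau).
have tt : t * t = f 1.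
  by rewrite -transf_EndM -of_permM tperm2 of_perm1.
have fE : f =1 collapse t e.
  move=> x; rewrite /collapse; case: parityP => [v|{}x /f_sing //].
  case: ifP => [v_odd|/negbT v_even]; last by rewrite tt f_even.
  rewrite -[v]mul1g -(tperm2 i0 i1) -mulgA of_permM transf_EndM.
  rewrite (f_even (_ * v)) ?odd_permM ?tau_odd ?v_odd //.
  by rewrite -transf_EndM mulg1.
have fc : f (cst i0) = e by rewrite fE /collapse parity_cst.
exists t, e; split=> //; split.
- by rewrite tt -transf_EndM mul1g.
- by rewrite -fc -transf_EndM mul_cst.
- by rewrite -fc -transf_EndM cst_mul fE fE /collapse !parity_cst.
- by rewrite -fc -transf_EndM mul_cst.
Qed.

Lemma mul_EndP f g g' : f * g = f * g' <-> forall x, g (f x) = g' (f x).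
Proof.
split=> [fg x|fg]; first by rewrite -!transf_EndME fg.
by apply/transf_End_eqP => x; rewrite !transf_EndME.
Qed.

Lemma idempotent_EndP f : idempotent_elt f <-> forall x, f (f x) = f x.
Proof.
split=> [ff x|ff]; first by rewrite -transf_EndME ff.
by apply/transf_End_eqP => x; rewrite transf_EndME.
Qed.

Lemma Rstar_ker f g : (forall x y, f x = f y <-> g x = g y) -> Rstar f g.
Proof.
move=> fg_ker c d; split=> cd; apply/transf_End_eqP => x; rewrite !transf_EndME;
  by apply/fg_ker; rewrite -!transf_EndME cd.
Qed.

Lemma injective_fixed f g : injective f -> f * g = f -> g = 1.
Proof.
move=> f_inj fg; apply/transf_End_eqP => x; rewrite transf_End1E.
by rewrite -(f_invF f_inj x) -transf_EndME fg.
Qed.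

(** The kernel depends only on which of t, t * t and e coincide, and
    t * t = e forces t = t * t * t = e * t = e. *)
Lemma collapse_ker t e t' e' : collapsing_pair t e -> collapsing_pair t' e' ->
  (t == e) = (t' == e') -> (t * t == t) = (t' * t' == t') ->
  forall x y, collapse t e x = collapse t e y <->
              collapse t' e' x = collapse t' e' y.
Proof.
have sq_eq a b : collapsing_pair a b -> (a * a == b) = (a == b).
  case=> aaa ab ba bb; apply/eqP/eqP => [aab|->//].
  by rewrite -aaa aab.
move=> te te' E1 E2 x y; rewrite /collapse.
have := sq_eq _ _ te; have := sq_eq _ _ te'; rewrite E1 => E3' E3.
rewrite -E3' in E3.
have eq_iff (a b a' b' : transf n) :
    (a == b) = (a' == b') -> a = b <-> a' = b'.
  by move=> ab; split=> /eqP; [rewrite ab|rewrite -ab] => /eqP.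
by case: (parity x) (parity y) => [[]|] [[]|] //; apply: eq_iff => //;
  rewrite eq_sym [RHS]eq_sym.
Qed.

Lemma collapse_idempotent t e f : f =1 collapse t e ->
  collapse t e t = t -> collapse t e e = e -> idempotent_elt f.
Proof.
move=> fE ft fe; apply/idempotent_EndP => x.
have fx : [\/ f x = t, f x = t * t | f x = e].
  by rewrite fE /collapse; case: (parity x) => [[]|]; constructor.
by case: fx => ->; rewrite ?transf_EndM ?fE ?ft ?fe.
Qed.

(** Let f collapse to t and e, and g to s and h.  Both t and e are fixed by g.
    If t is odd, the signs in t e = e force e to be singular, so f fixes t and
    e.  If t is even, then t = s * s is idempotent, and e is either singular or
    equal to s * s = t.  If t is singular, so is e = t e, whence t = h = e. *)
Lemma idempotent_of_fixed f g : 4 < n ->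
  idempotent_elt g -> g <> 1 -> f * g = f -> idempotent_elt f.
Proof.
move=> n_gt4 gg g_neq1 fg.
have g_ninj : ~ injective g.
  by move=> g_inj; apply/g_neq1/(injective_fixed g_inj).
have f_ninj : ~ injective f.
  by move=> f_inj; apply/g_neq1/(injective_fixed f_inj).
have [s [h [sh gE]]] := noninjective_collapse n_gt4 g_ninj.
have [t [e [te fE]]] := noninjective_collapse n_gt4 f_ninj.
have gf x : g (f x) = f x by rewrite -transf_EndME fg.
have n_gt1 : 1 < n by apply: leq_ltn_trans n_gt4.
have [i0 [i1 tau_odd]] := exists_odd_tperm n_gt1.
have gt : g t = t.
  have := gf (of_perm (tperm i0 i1)).
  by rewrite fE /collapse parity_perm tau_odd.
have ge : g e = e.
  by have := gf (cst i0); rewrite fE /collapse parity_cst.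
(* The parities in t * e = e and e * e = e exclude the combinations of signs
   in which f would not be idempotent. *)
have [ttt te_e _ ee] := te; have [sss _ _ _] := sh.
have := congr1 parity te_e; have := congr1 parity ee; rewrite !parityM.
move: gt ge; rewrite !gE /collapse.
case pt: (parity t) => [[]|]; case pe: (parity e) => [[]|] //= gt ge _ _;
  apply: (collapse_idempotent fE); rewrite /collapse ?pt ?pe //.
- by rewrite -gt mulgA sss.
- by rewrite -gt mulgA sss.
- by rewrite -gt mulgA sss.
- by rewrite -gt -ge.
Qed.

(** * Abundance and the Fountain properties *)

(** The two equations between booleans say, by [collapse_ker], that the kernels
    agree.  There are three cases.  If t = e, all is collapsed to 1.  If
    t * t = t <> e, permutations go to 1 and singular maps to a constant map.
    Otherwise t' is a transposition and e' a constant map at one of its fixed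
    points. *)
Lemma exists_idempotent_collapse t e : 2 < n -> collapsing_pair t e ->
  exists t' e', [/\ collapsing_pair t' e',
    (t == e) = (t' == e'), (t * t == t) = (t' * t' == t'),
    collapse t' e' t' = t' & collapse t' e' e' = e'].
Proof.
move=> n_gt2 [ttt te et ee]; have n_gt1 := ltnW n_gt2.
have [i0 [i1 tau_odd]] := exists_odd_tperm n_gt1.
have [i2] := @exists_notin [:: i0; i1] n_gt2.
rewrite !inE negb_or ![i2 == _]eq_sym => /andP[i02 i12].
have c_neq_perm s : (of_perm s == cst i2) = false.
  by apply/negP => /eqP/(congr1 parity); rewrite parity_perm parity_cst.
have [t_e|t_neq_e] := eqVneq t e.
  exists 1, 1; rewrite /collapsing_pair /collapse.
  by rewrite !parity1 !mulg1 t_e ee !eqxx.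
have [tt|tt_neq_t] := eqVneq (t * t) t.
  exists 1, (cst i2); rewrite /collapsing_pair /collapse parity1 parity_cst //.
  by rewrite !mul_cst cst_mul transf1E !mulg1 -of_perm1 c_neq_perm !eqxx.
exists (of_perm (tperm i0 i1)), (cst i2).
rewrite /collapsing_pair /collapse parity_perm tau_odd parity_cst //.
rewrite !mul_cst cst_mul of_permE tpermD // c_neq_perm -!of_permM tperm2 mul1g.
split=> //; apply/esym/negP => /eqP/(congr1 parity).
by rewrite !parity_perm odd_perm1 tau_odd.
Qed.

Lemma left_abundant_transf_End : 4 < n -> left_abundant (transf_End n).
Proof.
move=> n_gt4 f.
have [/injectiveP f_inj|/injectiveP f_ninj] := boolP (injectiveb f).
  exists 1; first by rewrite /idempotent_elt mul1g.
  by apply: Rstar_ker => x y; rewrite !transf_End1E; split=> [/f_inj|->].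
have [t [e [te fE]]] := noninjective_collapse n_gt4 f_ninj.
have [t' [e' [te' E1 E2 ct ce]]] :=
  exists_idempotent_collapse (ltnW (ltnW n_gt4)) te.
have [g gE] := collapse_end te'; exists g.
  exact: collapse_idempotent ct ce.
by apply: Rstar_ker => x y; rewrite !fE !gE; apply: collapse_ker.
Qed.

Lemma right_Fountain_transf_End : 4 < n -> right_Fountain (transf_End n).
Proof.
move=> n_gt4 f; have [ff|not_ff] := eqVneq (f * f) f; first by exists f.
exists 1; first by rewrite /idempotent_elt mul1g.
move=> g gg; rewrite mul1g; split=> [fg|->]; last by rewrite mulg1.
have [//|/eqP g_neq1] := eqVneq g 1.
by case/eqP: not_ff; apply: idempotent_of_fixed gg g_neq1 fg.
Qed.

(** Here e is constant and t is the idempotent of rank 2 that fixes i0 and i1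
    and sends all other points to i0.  All values of the collapse f to t and e
    are singular, so that f cannot distinguish two endomorphisms that differ
    only on permutations. *)
Lemma not_right_abundant_transf_End : 4 < n -> ~ right_abundant (transf_End n).
Proof.
move=> n_gt4 abundant.
have n_gt2 : 2 < n by apply: leq_ltn_trans n_gt4.
have n_gt1 := ltnW n_gt2.
have [i0 [i1 tau_odd]] := exists_odd_tperm n_gt1.
have i01 : i0 != i1 by move: tau_odd; rewrite odd_tperm.
have [i2] := @exists_notin [:: i0; i1] n_gt2.
rewrite !inE negb_or => /andP[i20 i21].
pose e := cst i0; pose t : transf n := [ffun i => if i == i1 then i1 else i0].
have ti0 : t i0 = i0 by rewrite ffunE (negPf i01).
have t_sing : parity t = None.
  apply: parity_singular => t_inj; case/eqP: i20; apply: t_inj.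
  by rewrite ti0 ffunE (negPf i21).
have e_sing : parity e = None by apply: parity_cst.
have tt : t * t = t.
  apply/ffunP => i; rewrite transfME [t i]ffunE; case: ifP => _ //.
  by rewrite ffunE eqxx.
have t_neq_e : t <> e.
  by move/ffunP/(_ i1); rewrite cstE ffunE eqxx => /esym/eqP; apply/negP.
have ee : e * e = e by apply: mul_cst.
have [f fE] : exists f, f =1 collapse t e.
  by apply: collapse_end; split; rewrite ?tt ?mul_cst ?cst_mul ?ti0.
have [g gg fLg] := abundant f.
have fg : f * g = f by rewrite -[RHS]mulg1; apply/fLg; rewrite mulg1.
have not_ff : ~ idempotent_elt f.
  move/idempotent_EndP/(_ 1).
  by rewrite !fE /collapse parity1 tt t_sing => /esym.
have g1 : g = 1.
  have [//|/eqP g_neq1] := eqVneq g 1.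
  by case: not_ff; apply: idempotent_of_fixed gg g_neq1 fg.
have [c cE] : exists c : transf_End n, c =1 collapse 1 e.
  by apply: collapse_end; split; rewrite ?mulg1 ?mul1g.
have [d dE] : exists d : transf_End n, d =1 collapse e e.
  by apply: collapse_end; split; rewrite ?ee.
have fcd : f * c = f * d.
  apply/mul_EndP => x; rewrite cE dE fE /collapse.
  by case: (parity x) => [[]|]; rewrite ?tt ?t_sing ?e_sing.
have /(congr1 (fun h : transf_End n => parity (h 1))) : c = d.
  by move/fLg: fcd; rewrite g1 !mul1g.
by rewrite cE dE /collapse parity1 mulg1 ee parity1 e_sing.
Qed.

End EndTransf.

Lemma left_abundant_Fountain (M : monoidType) :
  left_abundant M -> left_Fountain M.
Proof.
move=> abundant a; have [e ee aRe] := abundant a; exists e => // c _.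
by have := aRe c 1%g; rewrite !mul1g.
Qed.

Theorem proposition6p11 (n : nat) (hn : 5 <= n) :
  [/\ left_abundant (transf_End n),
      left_Fountain (transf_End n),
      right_Fountain (transf_End n)
    & ~ right_abundant (transf_End n)].
Proof.
have abundant := left_abundant_transf_End hn.
split=> //; first exact: left_abundant_Fountain.
- exact: right_Fountain_transf_End.
- exact: not_right_abundant_transf_End.
Qed.
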